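(* If $U\subseteq\mathbb{R}^2$ is any subset, then $\operatorname{tconv}\operatorname{conv}U=\operatorname{conv}\operatorname{tconv}U$.
   Context: Tropical semiring: $x\oplus y=\min(x,y)$ and $x\odot y=x+y$. For $c\in\mathbb{R}$ and $x\in\mathbb{R}^n$, $c\odot x=(c+x_1,\dots,c+x_n)$, and $\oplus$ of vectors is the coordinatewise minimum. A set $U\subseteq\mathbb{R}^n$ is tropically convex if $(c\odot x)\oplus(d\odot y)\in U$ for all $x,y\in U$ and all $c,d\in\mathbb{R}$ with $\min(c,d)=0$. The tropical convex hull $\operatorname{tconv}U$ is the smallest tropically convex set containing $U$. For finite $V=\{v_1,\dots,v_k\}$ it equals $\{c_1\odot v_1\oplus\cdots\oplus c_k\odot v_k:\min_i c_i=0\}$, and in general $\operatorname{tconv}U$ is the union of $\operatorname{tconv}V$ over finite $V\subseteq U$. $\operatorname{conv}$ denotes the ordinary convex hull. *)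

(* Defs.v *)
From mathcomp Require Import all_boot all_order all_algebra.
From mathcomp Require Import boolp classical_sets reals convex.

Set Implicit Arguments.
Unset Strict Implicit.
Unset Printing Implicit Defensive.

Import Order.TTheory GRing.Theory Num.Theory.

Local Open Scope classical_set_scope.
Local Open Scope ring_scope.

Definition trop_scale (R : realType) (n : nat) (c : R) (x : 'rV[R]_n) :
  'rV[R]_n := \row_i (c + x ord0 i).

Definition trop_add (R : realType) (n : nat) (x y : 'rV[R]_n) : 'rV[R]_n :=
  \row_i Num.min (x ord0 i) (y ord0 i).

Definition trop_convex (R : realType) (n : nat) (U : set 'rV[R]_n) : Prop :=
  forall (x y : 'rV[R]_n) (c d : R), U x -> U y -> Num.min c d = 0 ->
    U (trop_add (trop_scale c x) (trop_scale d y)).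

Definition tconv (R : realType) (n : nat) (U : set 'rV[R]_n) : set 'rV[R]_n :=
  smallest (@trop_convex R n) U.

(* [convex_set] is stated on the alias [convex_lmodType M] of an [lmodType] [M];
   the annotations make the hull a set of plain row vectors. *)
Definition conv_hull (R : realType) (n : nat) (U : set 'rV[R]_n) :
  set 'rV[R]_n :=
  smallest (fun A : set 'rV[R]_n => @convex_set R 'rV[R]_n A) U.

(* Main.v *)
(** For [z] in the tropical plane, the three sectors [z + C_i], where [C_i] is the
    set of [s] whose homogeneous coordinates [(0, s_0, s_1)] are minimal at [i],
    decide tropical membership: [z] lies in [tconv U] iff each sector meets [U].

    Sectors are convex and [z |-> z + C_i] is compatible with convex
    combinations, so the tropical hull of a convex set is convex.

    Conversely let [T] be tropically convex with ordinary hull [K], and let [K]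
    meet all sectors at [z]. If [T] meets them too then [z] is in [T]. Otherwise
    [T] misses a sector, say [C_0] at [z = 0]; then a tropical segment of [T]
    yields a point of [T] on the ray opposite to [C_0]. If [0] were not in [K],
    the complement of [C_0] in [K] would be convex: a segment of [K] joining two
    of its points through [C_0] crosses the diagonal in [C_0], and [0] lies
    between this crossing and the point on the opposite ray. Hence [K] would
    miss [C_0]. *)
Require Import Defs.
From mathcomp Require Import all_boot all_order all_algebra.
From mathcomp Require Import boolp classical_sets reals convex.
From mathcomp Require Import interval_inference ring lra.

Set Implicit Arguments.
Unset Strict Implicit.
Unset Printing Implicit Defensive.

Import Order.TTheory GRing.Theory Num.Theory.

Local Open Scope classical_set_scope.
Local Open Scope ring_scope.

(** * Hulls as smallest sets, ordinary and tropical *)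

Section Hulls.
Variables (R : realType) (n : nat).
Implicit Types (A U : set 'rV[R]_n) (x y : 'rV[R]_n).

Lemma convex_setE A :
  @convex_set R 'rV[R]_n A <->
  (forall x y (p : R), A x -> A y -> 0 <= p -> p <= 1 ->
     A (p *: x + (1 - p) *: y)).
Proof.
split=> [cA x y p Ax Ay p0 p1|cA x y p].
  exact: (set_mem (cA x y (Itv01 p0 p1) (mem_set Ax) (mem_set Ay))).
by move=> /set_mem Ax /set_mem Ay; apply/mem_set; exact: cA.
Qed.

Lemma conv_hull_convex U x y (p : R) : conv_hull U x -> conv_hull U y ->
  0 <= p -> p <= 1 -> conv_hull U (p *: x + (1 - p) *: y).
Proof.
move=> Ux Uy p0 p1 A cUA; case: (cUA) => /convex_setE cA _.
by apply: cA => //; [exact: Ux|exact: Uy].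
Qed.

Lemma sub_conv_hull U : U `<=` conv_hull U.
Proof. exact: sub_smallest. Qed.

Lemma conv_hull_min U A :
  (forall x y (p : R), A x -> A y -> 0 <= p -> p <= 1 ->
     A (p *: x + (1 - p) *: y)) ->
  U `<=` A -> conv_hull U `<=` A.
Proof. by move=> cA UA; apply: smallest_sub => //; apply/convex_setE. Qed.

Lemma tconv_convex U : trop_convex (tconv U).
Proof.
move=> x y c d Ux Uy cd A tUA; case: (tUA) => tA _.
by apply: tA => //; [exact: Ux|exact: Uy].
Qed.

Lemma sub_tconv U : U `<=` tconv U.
Proof. exact: sub_smallest. Qed.

Lemma tconv_min U A : trop_convex A -> U `<=` A -> tconv U `<=` A.
Proof. by move=> tA UA; apply: smallest_sub. Qed.

End Hulls.

Section TropicalPlane.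
Variable R : realType.
Implicit Types (T U : set 'rV[R]_2) (x y z s : 'rV[R]_2).

Let X s : R := s ord0 ord0.
Let Y s : R := s ord0 (lift ord0 ord0).

Lemma plane_eq x y : X x = X y -> Y x = Y y -> x = y.
Proof.
move=> h0 h1; apply/rowP => i.
have [->|[j ->]] : i = ord0 \/ exists j : 'I_1, i = lift ord0 j.
- by case: (unliftP ord0 i) => [j ->|->]; [right; exists j|left].
- exact: h0.
- by rewrite (ord1 j); exact: h1.
Qed.

Lemma XD (p q : R) x y : X (p *: x + q *: y) = p * X x + q * X y.
Proof. by rewrite /X !mxE. Qed.

Lemma YD (p q : R) x y : Y (p *: x + q *: y) = p * Y x + q * Y y.
Proof. by rewrite /Y !mxE. Qed.

Lemma Xtrop (c d : R) x y :
  X (trop_add (trop_scale c x) (trop_scale d y)) = Num.min (c + X x) (d + X y).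
Proof. by rewrite /X !mxE. Qed.

Lemma Ytrop (c d : R) x y :
  Y (trop_add (trop_scale c x) (trop_scale d y)) = Num.min (c + Y x) (d + Y y).
Proof. by rewrite /Y !mxE. Qed.

Lemma trop_convex_mem T z x y (c d : R) : trop_convex T -> T x -> T y ->
  Num.min c d = 0 -> X z = Num.min (c + X x) (d + X y) ->
  Y z = Num.min (c + Y x) (d + Y y) -> T z.
Proof.
move=> tT Tx Ty cd hX hY.
suff -> : z = trop_add (trop_scale c x) (trop_scale d y) by exact: tT.
by apply: plane_eq; rewrite ?hX ?hY ?Xtrop ?Ytrop.
Qed.

(** * The sector criterion for tropical hulls *)

Definition sector0 z s := X z <= X s /\ Y z <= Y s.
Definition sector1 z s := X s <= X z /\ X s - X z <= Y s - Y z.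
Definition sector2 z s := Y s <= Y z /\ Y s - Y z <= X s - X z.

Definition meets_sectors U z :=
  [/\ U `&` sector0 z !=set0, U `&` sector1 z !=set0 &
      U `&` sector2 z !=set0].

(** Shifting [u] to match [z] in the first coordinate and adding [s] gives [w] that agrees with [z]
    there and is no smaller in the second; adding [v], shifted to match the second coordinate, gives
    [z]. *)
Lemma trop_convex_meets_sectors T z :
  trop_convex T -> meets_sectors T z -> T z.
Proof.
move=> tT [[s [Ts [s0 s1]]] [u [Tu [u0 u1]]] [v [Tv [v0 v1]]]].
pose w := trop_add (trop_scale 0 s) (trop_scale (X z - X u) u).
have Tw : T w by apply: tT => //; rewrite min_l //; lra.
have Xw : X w = X z by rewrite Xtrop; case: leP; lra.
have Yw : Y z <= Y w by rewrite Ytrop le_min; apply/andP; split; lra.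
apply: (@trop_convex_mem T z w v 0 (Y z - Y v)) => //.
- by rewrite min_l //; lra.
- by rewrite Xw; case: leP; lra.
- by case: leP; lra.
Qed.

Lemma sub_meets_sectors U : U `<=` meets_sectors U.
Proof. by move=> x Ux; split; exists x; split=> //; split; lra. Qed.

(** In each of the three homogeneous coordinates, [z] agrees with a shifted [x] or [y] and is
    bounded by it in the others, so the corresponding sector at [z] contains the one at that
    point. *)
Lemma meets_sectors_trop_convex U : trop_convex (meets_sectors U).
Proof.
move=> x y c d [[x0 [Ux0 [a0 b0]]] [x1 [Ux1 [a1 b1]]] [x2 [Ux2 [a2 b2]]]].
move=> [[y0 [Uy0 [c0 d0]]] [y1 [Uy1 [c1 d1]]] [y2 [Uy2 [c2 d2]]]] cd.
set z := trop_add _ _.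
have XzE : X z = Num.min (c + X x) (d + X y) by exact: Xtrop.
have YzE : Y z = Num.min (c + Y x) (d + Y y) by exact: Ytrop.
have Xx : X z <= c + X x by rewrite XzE ge_min lexx.
have Xy : X z <= d + X y by rewrite XzE ge_min lexx orbT.
have Yx : Y z <= c + Y x by rewrite YzE ge_min lexx.
have Yy : Y z <= d + Y y by rewrite YzE ge_min lexx orbT.
have c_ge0 : 0 <= c by rewrite -cd ge_min lexx.
have d_ge0 : 0 <= d by rewrite -cd ge_min lexx orbT.
split.
- have [c_eq0|d_eq0] : c = 0 \/ d = 0 by move: cd; case: leP; [left|right].
  + by exists x0; split=> //; split; lra.
  + by exists y0; split=> //; split; lra.
- have [h|h] : X z = c + X x \/ X z = d + X y.
    by rewrite XzE; case: leP; [left|right].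
  + by exists x1; split=> //; split; lra.
  + by exists y1; split=> //; split; lra.
- have [h|h] : Y z = c + Y x \/ Y z = d + Y y.
    by rewrite YzE; case: leP; [left|right].
  + by exists x2; split=> //; split; lra.
  + by exists y2; split=> //; split; lra.
Qed.

Lemma tconv_meets_sectors U : tconv U = meets_sectors U.
Proof.
apply/seteqP; split.
  exact: tconv_min (@meets_sectors_trop_convex U) (@sub_meets_sectors U).
move=> z [[s [Us ?]] [u [Uu ?]] [v [Uv ?]]].
apply: trop_convex_meets_sectors; first exact: tconv_convex.
by split; [exists s|exists u|exists v]; split=> //; exact: sub_tconv.
Qed.

(** * Each hull preserves the other convexity *)

Lemma tconv_conv_hull_convex U x y (p : R) :
  tconv (conv_hull U) x -> tconv (conv_hull U) y -> 0 <= p -> p <= 1 ->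
  tconv (conv_hull U) (p *: x + (1 - p) *: y).
Proof.
rewrite tconv_meets_sectors.
move=> [[x0 [Ux0 [a0 b0]]] [x1 [Ux1 [a1 b1]]] [x2 [Ux2 [a2 b2]]]].
move=> [[y0 [Uy0 [c0 d0]]] [y1 [Uy1 [c1 d1]]] [y2 [Uy2 [c2 d2]]]] p0 p1.
have q0 : 0 <= 1 - p by lra.
split; [exists (p *: x0 + (1 - p) *: y0)|exists (p *: x1 + (1 - p) *: y1)
  |exists (p *: x2 + (1 - p) *: y2)];
  (split; [exact: conv_hull_convex|split; rewrite ?XD ?YD; nra]).
Qed.

(* [a] and [b] are affine coordinates centred at [z] in which some sector at [z]
   is the quadrant [0 <= a, 0 <= b]. *)
Lemma conv_hull_quadrant T z (a b : 'rV[R]_2 -> R) :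
  (forall x y (p : R), a (p *: x + (1 - p) *: y) = p * a x + (1 - p) * a y) ->
  (forall x y (p : R), b (p *: x + (1 - p) *: y) = p * b x + (1 - p) * b y) ->
  (forall s, a s = 0 -> b s = 0 -> s = z) ->
  (forall u v, T u -> T v -> a u < 0 -> 0 <= b u -> 0 <= a v -> b v < 0 ->
     exists q, [/\ T q, a q = b q & a q < 0]) ->
  (exists k, [/\ conv_hull T k, 0 <= a k & 0 <= b k]) ->
  conv_hull T z \/ exists s, [/\ T s, 0 <= a s & 0 <= b s].
Proof.
move=> aD bD abz trop [k [Kk ak bk]].
have [?|nKz] := pselect (conv_hull T z); [by left|right].
apply: contrapT => nT.
have [v Tv av] : exists2 v, T v & 0 <= a v.
  apply: contrapT => h.
  suff : a k < 0 by lra.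
  apply: (@conv_hull_min _ _ T [set s | a s < 0] _ _ k Kk) => [x y p|s Ts] /=.
    by move=> ax ay p0 p1; rewrite aD; nra.
  by rewrite ltNge; apply/negP => ?; apply: h; exists s.
have [u Tu bu] : exists2 u, T u & 0 <= b u.
  apply: contrapT => h.
  suff : b k < 0 by lra.
  apply: (@conv_hull_min _ _ T [set s | b s < 0] _ _ k Kk) => [x y p|s Ts] /=.
    by move=> bx bY p0 p1; rewrite bD; nra.
  by rewrite ltNge; apply/negP => ?; apply: h; exists s.
have bv : b v < 0 by rewrite ltNge; apply/negP => ?; apply: nT; exists v.
have au : a u < 0 by rewrite ltNge; apply/negP => ?; apply: nT; exists u.
have [q [Tq abq aq]] := trop u v Tu Tv au bu av bv.
have {}Kq := sub_conv_hull Tq.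
(* On the diagonal [a = b], the weight that cancels [a] cancels [b] too, so [z] lies between [m] and
   [q]. *)
have no_diag m : conv_hull T m -> a m = b m -> 0 <= a m -> False.
  move=> Km abm am; apply: nKz.
  have am_q : a m - a q != 0 by apply/eqP; lra.
  rewrite -(abz (- a q / (a m - a q) *: m + (1 - - a q / (a m - a q)) *: q)).
  - apply: conv_hull_convex => //.
    + by apply: divr_ge0; lra.
    + by rewrite ler_pdivrMr; lra.
  - by rewrite aD; field.
  - by rewrite bD -abm -abq; field.
have no_cross x y (p : R) : conv_hull T x -> conv_hull T y -> 0 <= p -> p <= 1 ->
    a x < 0 -> b y < 0 -> 0 <= p * a x + (1 - p) * a y ->
    0 <= p * b x + (1 - p) * b y -> False.
  move=> Kx Ky p0 p1 ax by_ ha hb.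
  have p_gt0 : 0 < p by rewrite lt_neqAle p0 andbT; apply/eqP => p_eq0; nra.
  have p_lt1 : p < 1 by rewrite lt_neqAle p1 andbT; apply/eqP => p_eq1; nra.
  have ay : 0 < a y by nra.
  have bx : 0 < b x by nra.
  (* The sign of the value at the diagonal crossing: multiply the two entry conditions and cancel
     [p * (1 - p)]. *)
  have det : 0 <= a y * b x - a x * b y.
    have h1 : p * - a x <= (1 - p) * a y by lra.
    have h2 : (1 - p) * - b y <= p * b x by lra.
    have h3 : (p * - a x) * ((1 - p) * - b y) <= ((1 - p) * a y) * (p * b x).
      by apply: ler_pM => //; nra.
    have h4 : 0 < p * (1 - p) by nra.
    by rewrite -(pmulr_rge0 _ h4); lra.
  pose e := (a y - b y) + (b x - a x).
  have e_gt0 : 0 < e by rewrite /e; lra.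
  have e_neq0 : (a y - b y) + (b x - a x) != 0 by rewrite -/e gt_eqF.
  (* This weight solves [a = b] on the line through [x] and [y]. *)
  apply: (no_diag (((a y - b y) / e) *: x + (1 - (a y - b y) / e) *: y)).
  - apply: conv_hull_convex => //.
    + by apply: divr_ge0; lra.
    + by rewrite ler_pdivrMr // /e; lra.
  - by rewrite aD bD /e; field.
  - rewrite aD.
    suff -> : (a y - b y) / e * a x + (1 - (a y - b y) / e) * a y =
      (a y * b x - a x * b y) / e by apply: divr_ge0 => //; exact: ltW.
    by rewrite /e; field.
(* The part of the hull outside the quadrant is convex and contains [T], hence is the whole hull,
   against [k]. *)
suff [_] : conv_hull T k /\ (a k < 0 \/ b k < 0) by case; lra.
apply: (@conv_hull_min _ _ T
  [set s | conv_hull T s /\ (a s < 0 \/ b s < 0)] _ _ k Kk) => [x y p|s Ts] /=.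
  move=> [Kx hx] [Ky hy] p0 p1; split; first exact: conv_hull_convex.
  rewrite aD bD.
  have [?|ha] := ltP (p * a x + (1 - p) * a y) 0; first by left.
  have [?|hb] := ltP (p * b x + (1 - p) * b y) 0; first by right.
  exfalso; case: hx => hx; case: hy => hy; [nra| | |nra].
  - exact: (no_cross x y p).
  - by apply: (no_cross y x (1 - p)) => //; lra.
split; first exact: sub_conv_hull.
have [?|as0] := ltP (a s) 0; first by left.
have [?|bs0] := ltP (b s) 0; first by right.
by exfalso; apply: nT; exists s.
Qed.

Lemma conv_hull_trop_convex T : trop_convex T -> trop_convex (conv_hull T).
Proof.
move=> tT x y c d Kx Ky cd.
set z := trop_add _ _.
have [[s [Ks [s0 s1]]] [u [Ku [u0 u1]]] [v [Kv [v0 v1]]]] :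
    meets_sectors (conv_hull T) z.
  by apply: meets_sectors_trop_convex => //; exact: sub_meets_sectors.
clearbody z.
have [//|[s' [Ts' ? ?]]] : conv_hull T z \/
    exists s, [/\ T s, 0 <= X s - X z & 0 <= Y s - Y z].
  apply: conv_hull_quadrant.
  - by move=> *; rewrite XD; ring.
  - by move=> *; rewrite YD; ring.
  - by move=> *; apply: plane_eq; lra.
  - move=> f g Tf Tg f0 f1 g0 g1.
    (* Only nonnegative shifts are allowed, so the point with the lower negative coordinate is
       raised until the two negative coordinates agree. *)
    have [h|h] := leP (X f - X z) (Y g - Y z).
    + set e := (Y g - Y z) - (X f - X z).
      pose q := trop_add (trop_scale e f) (trop_scale 0 g).
      exists q; split.
      * by apply: tT => //; rewrite min_r // /e; lra.
      * by rewrite Xtrop Ytrop /e; case: leP => ?; case: leP => ?; lra.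
      * by rewrite Xtrop /e; case: (leP (_ + _)); lra.
    + set e := (X f - X z) - (Y g - Y z).
      pose q := trop_add (trop_scale 0 f) (trop_scale e g).
      exists q; split.
      * by apply: tT => //; rewrite min_l // /e; lra.
      * by rewrite Xtrop Ytrop /e; case: leP => ?; case: leP => ?; lra.
      * by rewrite Xtrop /e; case: (leP (_ + _)); lra.
  - by exists s; split=> //; lra.
have [//|[u' [Tu' ? ?]]] : conv_hull T z \/
    exists s, [/\ T s, 0 <= X z - X s & 0 <= (Y s - Y z) - (X s - X z)].
  apply: conv_hull_quadrant.
  - by move=> *; rewrite XD; ring.
  - by move=> *; rewrite XD YD; ring.
  - by move=> *; apply: plane_eq; lra.
  - move=> f g Tf Tg f0 f1 g0 g1.
    (* Here [a = b] is the line [Y = Y z]: [g] lies below it and is raised onto it, while [f] lies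
       above. *)
    set e := Y z - Y g.
    pose q := trop_add (trop_scale 0 f) (trop_scale e g).
    exists q; split.
    + by apply: tT => //; rewrite min_l // /e; lra.
    + by rewrite Xtrop Ytrop /e; case: leP => ?; case: leP => ?; lra.
    + by rewrite Xtrop /e; case: (leP (_ + _)); lra.
  - by exists u; split=> //; lra.
have [//|[v' [Tv' ? ?]]] : conv_hull T z \/
    exists s, [/\ T s, 0 <= Y z - Y s & 0 <= (X s - X z) - (Y s - Y z)].
  apply: conv_hull_quadrant.
  - by move=> *; rewrite YD; ring.
  - by move=> *; rewrite XD YD; ring.
  - by move=> *; apply: plane_eq; lra.
  - move=> f g Tf Tg f0 f1 g0 g1.
    set e := X z - X g.
    pose q := trop_add (trop_scale 0 f) (trop_scale e g).
    exists q; split.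
    + by apply: tT => //; rewrite min_l // /e; lra.
    + by rewrite Xtrop Ytrop /e; case: leP => ?; case: leP => ?; lra.
    + by rewrite Ytrop /e; case: (leP (_ + _)); lra.
  - by exists v; split=> //; lra.
apply: sub_conv_hull; apply: trop_convex_meets_sectors => //.
by split; [exists s'|exists u'|exists v']; split=> //; split; lra.
Qed.

End TropicalPlane.

Theorem theorem1p10 (R : realType) (U : set 'rV[R]_2) :
  tconv (conv_hull U) = conv_hull (tconv U).
Proof.
(* Each side contains [U] and is closed under both convexities, so minimality of the hulls gives
   both inclusions. *)
apply/seteqP; split.
- apply: tconv_min.
    exact: conv_hull_trop_convex (@tconv_convex _ _ U).
  apply: conv_hull_min => [x y p|x Ux]; first exact: conv_hull_convex.
  by apply: sub_conv_hull; apply: sub_tconv.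
- apply: conv_hull_min => [x y p|]; first exact: tconv_conv_hull_convex.
  apply: tconv_min; first exact: tconv_convex.
  by move=> x Ux; apply: sub_tconv; apply: sub_conv_hull.
Qed.
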